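(* Let $f:\mathbb{R}^d\to\mathbb{R}$ be a differentiable pseudoconvex function with at least one global minimizer. Then $f\in\mathcal{F}_{\mathbf{I}}^{\mathrm{BA}}(t)$ for every $t>0$.
   Context: A differentiable $f:\mathbb{R}^d\to\mathbb{R}$ is pseudoconvex if for all $x,y\in\mathbb{R}^d$: $\langle\nabla f(x),y-x\rangle\ge 0$ implies $f(y)\ge f(x)$. Let $\langle\cdot,\cdot\rangle$, $\|\cdot\|$ be the Euclidean inner product and norm and $\mathcal{B}(x,t)=\{z\in\mathbb{R}^d:\|z-x\|\le t\}$. For $f:\mathbb{R}^d\to\mathbb{R}\cup\{+\infty\}$, $\operatorname{dom} f=\{x: f(x)<+\infty\}$; $f$ is proper if $\operatorname{dom} f\ne\emptyset$ and closed if it is lower semicontinuous; $\mathcal{X}_f$ is the set of global minimizers of $f$; $\mathrm{brox}^t_f(x)=\arg\min_{z\in\mathcal{B}(x,t)}f(z)$ (a set); $\mathcal{X}_f+\mathcal{B}(0,t)$ is the Minkowski sum. The class $\mathcal{F}_{\mathbf{I}}^{\mathrm{BA}}(t)$ consists of all proper, closed $f:\mathbb{R}^d\to\mathbb{R}\cup\{+\infty\}$ such that both of the following hold. (A) There exists $x_\star\in\mathcal{X}_f$ such that for every $x\in\operatorname{dom} f\setminus(\mathcal{X}_f+\mathcal{B}(0,t))$ and every $u\in\mathrm{brox}^t_f(x)$, $\langle x-u,\,x_\star-u\rangle\le 0$. (B) For all $x\in\operatorname{dom} f$: if $\mathrm{brox}^t_f(x)=\{x\}$, then $x\in\mathcal{X}_f$.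 *)

(* Defs.v *)
From mathcomp Require Import all_boot all_order all_algebra.
From mathcomp Require Import all_classical all_reals all_analysis.

Set Implicit Arguments.
Unset Strict Implicit.
Unset Printing Implicit Defensive.

Import Order.TTheory GRing.Theory Num.Theory.
Import numFieldNormedType.Exports.

Local Open Scope classical_set_scope.
Local Open Scope ring_scope.

Definition dotprod (R : realType) (d : nat) (u v : 'rV[R]_d) : R :=
  \sum_(i < d) u ord0 i * v ord0 i.

(* The canonical norm of 'rV[R]_d is the sup norm, so the Euclidean norm and
   its balls are defined here. Topological notions (lower semicontinuity,
   differentiability) are those of 'rV[R]_d: both norms are equivalent. *)
Definition enorm (R : realType) (d : nat) (u : 'rV[R]_d) : R :=
  Num.sqrt (dotprod u u).

Definition ecball (R : realType) (d : nat) (x : 'rV[R]_d) (t : R)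
    : set 'rV[R]_d :=
  [set z | enorm (z - x) <= t].

Definition msum (R : realType) (d : nat) (A B : set 'rV[R]_d)
    : set 'rV[R]_d :=
  [set a + b | a in A & b in B].

Definition grad (R : realType) (d : nat) (f : 'rV[R]_d -> R) (x : 'rV[R]_d)
    : 'rV[R]_d :=
  \row_(i < d) 'D_(delta_mx ord0 i) f x.

Definition pseudoconvex (R : realType) (d : nat) (f : 'rV[R]_d -> R) : Prop :=
  forall x y : 'rV[R]_d, 0 <= dotprod (grad f x) (y - x) -> f x <= f y.

Definition dom (R : realType) (d : nat) (f : 'rV[R]_d -> \bar R)
    : set 'rV[R]_d :=
  [set x | (f x < +oo)%E].

Definition argmin (R : realType) (d : nat) (A : set 'rV[R]_d)
    (f : 'rV[R]_d -> \bar R) : set 'rV[R]_d :=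
  [set z | A z /\ forall y, A y -> (f z <= f y)%E].

Definition minimizers (R : realType) (d : nat) (f : 'rV[R]_d -> \bar R)
    : set 'rV[R]_d :=
  argmin setT f.

Definition brox (R : realType) (d : nat) (t : R) (f : 'rV[R]_d -> \bar R)
    (x : 'rV[R]_d) : set 'rV[R]_d :=
  argmin (ecball x t) f.

Definition conditionA (R : realType) (d : nat) (t : R)
    (f : 'rV[R]_d -> \bar R) : Prop :=
  exists2 xs, minimizers f xs &
    forall x, (dom f `\` msum (minimizers f) (ecball 0 t)) x ->
    forall u, brox t f x u -> dotprod (x - u) (xs - u) <= 0.

Definition conditionB (R : realType) (d : nat) (t : R)
    (f : 'rV[R]_d -> \bar R) : Prop :=
  forall x, dom f x -> brox t f x = [set x] -> minimizers f x.

(* The first conjunct restricts the codomain \bar R to R U {+oo}. *)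
Definition classFIBA (R : realType) (d : nat) (t : R)
    : set ('rV[R]_d -> \bar R) :=
  [set f | [/\ forall x, f x != -oo%E,
               dom f !=set0,
               lower_semicontinuous f,
               conditionA t f &
               conditionB t f]].

(* Main.v *)
Require Import Defs.
From mathcomp Require Import all_boot all_order all_algebra.
From mathcomp Require Import all_classical all_reals all_analysis.
From mathcomp Require Import ring lra.
Import Order.TTheory GRing.Theory Num.Theory.
Import numFieldNormedType.Exports.
Local Open Scope classical_set_scope.
Local Open Scope ring_scope.

(** A differentiable function that does not decrease along the first part of a
    ray from [u] in direction [w] has nonnegative derivative there, that is
    <grad f u, w> >= 0; for a pseudoconvex [f] this first-order information is
    already global and yields f u <= f (u + w).  So if [u] minimizes [f] over a
    ball and the segment from [u] to [y] starts out inside the ball, then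
    f u <= f y ([brox_le]).  Both conditions follow by exhibiting such segments.

    (B) If [x] minimizes [f] over the ball centered at [x], then every segment
    issued from [x] starts inside that ball, so [x] is a global minimizer.

    (A) Take any global minimizer [xs], and let [u] minimize [f] over the ball
    of center [x].  If <x - u, xs - u> > 0, the direction xs - u makes an acute
    angle with x - u, so moving from [u] towards [xs] first decreases the
    distance to [x] and stays in the ball, even when [u] is on the sphere.
    Hence f u <= f xs: [u] is itself a global minimizer, at distance at most
    [t] from [x], which is excluded.  This avoids the usual computation of
    x - u as a positive multiple of grad f u. *)

Section EuclideanBall.
Context {R : realType} {d : nat}.
Implicit Types u v w x z : 'rV[R]_d.

Lemma dotprodC u v : dotprod u v = dotprod v u.
Proof. by apply: eq_bigr => i _; rewrite mulrC. Qed.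

Lemma dotprod_sqr_ge0 u : 0 <= dotprod u u.
Proof. by apply: sumr_ge0 => i _; rewrite -expr2 sqr_ge0. Qed.

Lemma dotprod_sqrD u v :
  dotprod (u + v) (u + v) = dotprod u u + dotprod u v *+ 2 + dotprod v v.
Proof.
rewrite /dotprod -sumrMnl -!big_split /=; apply: eq_bigr => i _.
by rewrite !mxE; ring.
Qed.

Lemma dotprodZr (a : R) u v : dotprod u (a *: v) = a * dotprod u v.
Proof. by rewrite mulr_sumr; apply: eq_bigr => i _; rewrite !mxE; ring. Qed.

Lemma dotprodNl u v : dotprod (- u) v = - dotprod u v.
Proof. by rewrite -sumrN; apply: eq_bigr => i _; rewrite !mxE; ring. Qed.

Lemma enormN u : enorm (- u) = enorm u.
Proof. by rewrite /enorm dotprodNl dotprodC dotprodNl opprK. Qed.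

Lemma ecballE x z (t : R) :
  0 <= t -> ecball x t z = (dotprod (z - x) (z - x) <= t ^+ 2) :> Prop.
Proof.
move=> t0; rewrite /ecball /= /enorm.
by rewrite -{1}(ger0_norm t0) -sqrtr_sqr ler_sqrt ?sqr_ge0.
Qed.

Lemma near_at_right0_mul_le (b c : R) :
  0 < c -> \forall s \near (0 : R)^'+, s * b <= c.
Proof.
move=> c0; have b1 : 0 < `|b| + 1 by rewrite ltr_wpDl.
near=> s; have s0 : 0 < s by [].
have : s < c / (`|b| + 1).
  by near: s; apply: nbhs_right_lt; rewrite divr_gt0.
rewrite ltr_pdivlMr // => /ltW; apply: le_trans.
by rewrite ler_pM2l // (le_trans (ler_norm b)) // lerDl.
Unshelve. all: by end_near. Qed.

Lemma ecball_center_ray x w (t : R) :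
  0 < t -> \forall s \near (0 : R)^'+, ecball x t (x + s *: w).
Proof.
move=> t0; near=> s; rewrite ecballE ?(ltW t0)// addrAC subrr add0r.
have s0 : 0 < s by [].
have s1 : s < 1 by near: s; apply: nbhs_right_lt.
have sw : s * dotprod w w <= t ^+ 2.
  by near: s; apply: near_at_right0_mul_le; rewrite exprn_gt0.
apply: le_trans sw; rewrite dotprodZr dotprodC dotprodZr.
by rewrite ler_piMl ?(ltW s1) ?mulr_ge0 ?dotprod_sqr_ge0 ?(ltW s0).
Unshelve. all: by end_near. Qed.

(** The squared distance to [x] at time [s] is
    |u - x|^2 - 2 s <x - u, w> + s^2 |w|^2, whose linear term wins for
    small [s]. *)
Lemma ecball_acute_ray x u w (t : R) : 0 <= t ->
  ecball x t u -> 0 < dotprod (x - u) w ->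
  \forall s \near (0 : R)^'+, ecball x t (u + s *: w).
Proof.
move=> t0; rewrite ecballE // => xu xuw; near=> s; rewrite ecballE // addrAC.
have s0 : 0 < s by [].
have sw : s * dotprod w w <= dotprod (x - u) w *+ 2.
  by near: s; apply: near_at_right0_mul_le; rewrite mulrn_wgt0.
apply: le_trans xu; rewrite (dotprod_sqrD (u - x)) !dotprodZr.
rewrite (dotprodC (s *: w)) dotprodZr -(opprB x u) !dotprodNl.
have : s * (s * dotprod w w) <= s * (dotprod (x - u) w *+ 2).
  by rewrite ler_pM2l.
rewrite (dotprodC _ (- _)) dotprodNl; lra.
Unshelve. all: by end_near. Qed.

End EuclideanBall.

Section FirstOrder.
Context {R : realType} {d : nat}.
Implicit Types (f : 'rV[R]_d -> R) (u v w x y : 'rV[R]_d).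

Lemma derive_grad f x v : differentiable f x ->
  'D_v f x = dotprod (grad f x) v.
Proof.
move=> fx; rewrite deriveE // {1}(row_sum_delta v) linear_sum /=.
by apply: eq_bigr => i _; rewrite linearZ /= mxE deriveE // mulrC.
Qed.

Lemma derive_ge0_at_right f u w : derivable f u w ->
  (\forall s \near (0 : R)^'+, f u <= f (u + s *: w)) -> 0 <= 'D_w f u.
Proof.
move=> fuw fle; have /cvg_dnbhs_at_right := fuw.
move=> /cvgr_to_ge; apply; near=> s.
have s0 : 0 < s by [].
rewrite /= [_ *: _]mulrC pmulr_lge0 ?invr_gt0 // subr_ge0 addrC.
by near: s.
Unshelve. all: by end_near. Qed.

Lemma brox_le f (t : R) x u y :
  differentiable f u -> pseudoconvex f -> brox t (EFin \o f) x u ->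
  (\forall s \near (0 : R)^'+, ecball x t (u + s *: (y - u))) -> f u <= f y.
Proof.
move=> fu pf [_ minu] ball_seg; apply: pf; rewrite -derive_grad //.
apply: derive_ge0_at_right; first exact: diff_derivable.
by apply: filterS ball_seg => s /minu; rewrite lee_fin.
Qed.

End FirstOrder.

Lemma continuous_lower_semicontinuous {R : realType} {X : topologicalType}
  (f : X -> R) : continuous f -> lower_semicontinuous (EFin \o f).
Proof.
move=> cf x a; rewrite lte_fin => afx.
by exists [set y | a < f y] => //; exact: (cvgr_gt (f x) (cf x)).
Qed.

Theorem theorem5p2 (R : realType) (d : nat) (f : 'rV[R]_d -> R)
    (f_diff : forall x : 'rV[R]_d, differentiable f x)
    (f_pseudoconvex : pseudoconvex f)
    (f_min : minimizers (EFin \o f) !=set0)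
    (t : R) (t_gt0 : 0 < t) :
  classFIBA t (EFin \o f).
Proof.
split=> //.
- by exists 0; rewrite /dom /= ltry.
- apply: continuous_lower_semicontinuous => x.
  exact: differentiable_continuous.
- have [xs xs_min] := f_min; exists xs => // x [_ x_far] u ux.
  rewrite leNgt; apply/negP => acute; apply: x_far.
  have [xu _] := ux.
  have u_le : f u <= f xs.
    by apply: brox_le ux _ => //; apply: ecball_acute_ray => //; exact: ltW.
  have u_min : minimizers (EFin \o f) u.
    split=> // y _; apply: le_trans (xs_min.2 y I).
    by rewrite lee_fin.
  exists u => //; exists (x - u); last by rewrite addrC subrK.
  by rewrite /ecball /= subr0 -enormN opprB.
- move=> x _ brox_x; have xx : brox t (EFin \o f) x x by rewrite brox_x.
  split=> // y _; rewrite lee_fin.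
  by apply: brox_le xx _ => //; exact: ecball_center_ray.
Qed.
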